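(* Suppose the regular function $\phi=\phi(t,\xi,\eta)$ satisfies $$\begin{aligned} &\phi_t-\nu(2\partial_\xi^2+\partial_\eta^2)\phi=0,\\ &\phi(t,\xi+2\pi,\eta)=\phi(t,\xi,\eta),\quad\forall t\ge0,\ \xi\in\mathbb{R},\ \eta\in(L_1,L_2),\\ &\phi(t,\xi,\eta)\big|_{\eta=L_1}=\phi(t,\xi,\eta)\big|_{\eta=L_2}=0,\quad\forall t\ge0,\ \xi\in\mathbb{R},\\ &\phi(t,\xi,\eta)\big|_{t=0}=\phi_0(\xi,\eta), \end{aligned}$$ and let $$u_{ns}^{pp}(t,x)=\big(-\partial_2\phi(t,x_1+x_2,x_3),\ \partial_1\phi(t,x_1+x_2,x_3),\ 0\big).$$ Then $$\lim_{\nu\to0}u_{ns}^{pp}(t,x)=\big(-\partial_2\phi_0(x_1+x_2,x_3),\ \partial_1\phi_0(x_1+x_2,x_3),\ 0\big)=u_{e0}^{pp}(x),$$ and $u=u_{e0}^{pp}(x)$ is a solution of the static incompressible Euler equations $(u\cdot\nabla)u+\nabla P=0$, $\nabla\cdot u=0$ (with some scalar pressure $P$) with boundary condition $$\begin{aligned} &u(x_1+2\pi,x_2,x_3)=u(x_1,x_2,x_3),\quad\forall(x_1,x_2)\in\mathbb{R}^2,\ x_3\in(L_1,L_2),\\ &u(x_1,x_2+2\pi,x_3)=u(x_1,x_2,x_3),\quad\forall(x_1,x_2)\in\mathbb{R}^2,\ x_3\in(L_1,L_2),\\ &u_3(x_1,x_2,x_3)\big|_{x_3=L_1}=u_3(x_1,x_2,x_3)\big|_{x_3=L_2}=0,\quad\forall(x_1,x_2)\in\mathbb{R}^2.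 \end{aligned}$$ Here a Prandtl layer does not appear.
   Context: Here $x=(x_1,x_2,x_3)$, $\nabla=(\partial_1,\partial_2,\partial_3)$, $\partial_j=\partial/\partial x_j$, and $\partial_j\phi(t,x_1+x_2,x_3)$ denotes the $x_j$-derivative of the composite function $x\mapsto\phi(t,x_1+x_2,x_3)$ (similarly for $\phi_0$); $u_3$ is the third component of $u$; $L_1<L_2$ are constants and $\nu>0$ is the viscosity coefficient. The field $u_{ns}^{pp}$ is a solution of the incompressible Navier-Stokes equations $u_t-\nu\Delta u+(u\cdot\nabla)u+\nabla P=0$, $\nabla\cdot u=0$, which is $2\pi$-periodic in $x_1$ and in $x_2$, vanishes at $x_3=L_1$ and $x_3=L_2$ for all $t\ge0$, and has initial data $\big(-\partial_2\phi_0(x_1+x_2,x_3),\partial_1\phi_0(x_1+x_2,x_3),0\big)$. *)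

(* Defs.v *)
From HB Require Import structures.
From mathcomp Require Import all_boot all_order all_algebra.
From mathcomp Require Import all_classical all_reals all_analysis.
Set Implicit Arguments.
Unset Strict Implicit.
Unset Printing Implicit Defensive.
Import Order.TTheory GRing.Theory Num.Theory.
Import numFieldNormedType.Exports.
Local Open Scope classical_set_scope.
Local Open Scope ring_scope.

Definition vec3 (R : realType) (a b c : R) : 'rV[R]_3 :=
  \row_(j < 3) [:: a; b; c]`_j.

(** Calculus in R^n.  Coordinates are numbered from 0, so that the coordinate
    x_1 of the mathematical text is [x 0 0], and d/dx_1 is [partial 0]. *)

Definition partial (R : realType) (n : nat) (j : 'I_n.+1)
    (f : 'rV[R]_n.+1 -> R) (x : 'rV[R]_n.+1) : R :=
  'D_(delta_mx 0 j) f x.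

Definition laplacian (R : realType) (n : nat) (f : 'rV[R]_n.+1 -> R)
    (x : 'rV[R]_n.+1) : R :=
  \sum_(j < n.+1) partial j (partial j f) x.

Definition divergence (R : realType) (n : nat)
    (u : 'rV[R]_n.+1 -> 'rV[R]_n.+1) (x : 'rV[R]_n.+1) : R :=
  \sum_(j < n.+1) partial j (fun y => u y 0 j) x.

(** i-th component of (u . grad) u *)
Definition convection (R : realType) (n : nat)
    (u : 'rV[R]_n.+1 -> 'rV[R]_n.+1) (i : 'I_n.+1) (x : 'rV[R]_n.+1) : R :=
  \sum_(j < n.+1) u x 0 j * partial j (fun y => u y 0 i) x.

(** f is of class C^k on the open set A.  Openness of A matters: [partial] is
    a two-sided derivative. *)
Fixpoint class_C (R : realType) (n k : nat) (A : set 'rV[R]_n.+1)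
    (f : 'rV[R]_n.+1 -> R) : Prop :=
  (forall x, A x -> {for x, continuous f}) /\
  match k with
  | 0%N => True
  | k'.+1 => forall j : 'I_n.+1,
      (forall x, A x -> derivable f x (delta_mx 0 j)) /\
      class_C k' A (partial j f)
  end.

Definition strip (R : realType) (L1 L2 : R) : set 'rV[R]_3 :=
  [set x | L1 < x 0 2 < L2].

Definition closed_strip (R : realType) (L1 L2 : R) : set 'rV[R]_3 :=
  [set x | L1 <= x 0 2 <= L2].

(** Scalar functions phi(t, xi, eta) and phi0(xi, eta) seen as functions on R^3
    and R^2. *)

Definition on_R3 (R : realType) (phi : R -> R -> R -> R) (p : 'rV[R]_3) : R :=
  phi (p 0 0) (p 0 1) (p 0 2).

Definition on_R2 (R : realType) (phi0 : R -> R -> R) (q : 'rV[R]_2) : R :=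
  phi0 (q 0 0) (q 0 1).

Definition open_domain (R : realType) (L1 L2 : R) : set 'rV[R]_3 :=
  [set p | 0 < p 0 0 /\ L1 < p 0 2 < L2].

Definition closed_domain (R : realType) (L1 L2 : R) : set 'rV[R]_3 :=
  [set p | 0 <= p 0 0 /\ L1 <= p 0 2 <= L2].

(** Regularity of phi(t, xi, eta), 0 <= t, L1 <= eta <= L2.  The velocity built
    from phi is (- d_xi phi, d_xi phi, 0): class C^3 makes it C^2, as the
    Navier-Stokes equations require.  Up to t = 0 and up to the walls only
    continuity of phi and of this velocity is asked; d_xi is tangential to both,
    so it is a two-sided derivative there as well.  Any function which is smooth
    up to the boundary is regular in this sense. *)
Definition regular (R : realType) (L1 L2 : R) (phi : R -> R -> R -> R) : Prop :=
  [/\ class_C 3 (open_domain L1 L2) (on_R3 phi),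
      {within closed_domain L1 L2, continuous (on_R3 phi)},
      (forall p, closed_domain L1 L2 p ->
         derivable (on_R3 phi) p (delta_mx 0 1)) &
      {within closed_domain L1 L2, continuous (partial 1 (on_R3 phi))}].

Definition regular_initial (R : realType) (L1 L2 : R) (phi0 : R -> R -> R) :
    Prop :=
  class_C 2 [set q : 'rV[R]_2 | L1 < q 0 1 < L2] (on_R2 phi0).

(** (- d_2 psi(x1 + x2, x3), d_1 psi(x1 + x2, x3), 0), where the derivatives are
    those of the composite function x |-> psi(x1 + x2, x3). *)
Definition u_pp (R : realType) (psi : R -> R -> R) (x : 'rV[R]_3) : 'rV[R]_3 :=
  let psix := fun y : 'rV[R]_3 => psi (y 0 0 + y 0 1) (y 0 2) in
  vec3 (- partial 1 psix x) (partial 0 psix x) 0.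

Definition periodic12 (R : realType) (L1 L2 : R) (u : 'rV[R]_3 -> 'rV[R]_3) :
    Prop :=
  forall x1 x2 x3 : R, L1 < x3 < L2 ->
    u (vec3 (x1 + 2 * pi) x2 x3) = u (vec3 x1 x2 x3) /\
    u (vec3 x1 (x2 + 2 * pi) x3) = u (vec3 x1 x2 x3).

(** Classical solution, with pressure P, of
      u_t - nu Lap u + (u . grad) u + grad P = 0,  div u = 0
    in the strip, 2pi-periodic in x1 and x2, vanishing on the walls, with initial
    data u0; u is continuous up to t = 0 and up to the walls, so that initial and
    boundary values are attained. *)
Definition navier_stokes_solution (R : realType) (nu L1 L2 : R)
    (u0 : 'rV[R]_3 -> 'rV[R]_3)
    (u : R -> 'rV[R]_3 -> 'rV[R]_3) (P : R -> 'rV[R]_3 -> R) : Prop :=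
  [/\ (forall t, 0 < t ->
         class_C 1 (strip L1 L2) (P t) /\
         forall i : 'I_3, class_C 2 (strip L1 L2) (fun x => u t x 0 i)),
      (forall (t : R) x, 0 < t -> strip L1 L2 x ->
         divergence (u t) x = 0 /\
         forall i : 'I_3,
           derivable (fun s : R => u s x 0 i) t 1 /\
           'D_1 (fun s : R => u s x 0 i) t
             - nu * laplacian (fun y => u t y 0 i) x
             + convection (u t) i x + partial i (P t) x = 0),
      (forall t, 0 <= t -> periodic12 L1 L2 (u t)) /\
      (forall t x1 x2 : R, 0 <= t ->
         u t (vec3 x1 x2 L1) = 0 /\ u t (vec3 x1 x2 L2) = 0),
      (forall x, closed_strip L1 L2 x -> u 0 x = u0 x) &
      {within [set p : R * 'rV[R]_3 | 0 <= p.1 /\ closed_strip L1 L2 p.2],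
        continuous (fun p => u p.1 p.2)}].

(** Classical solution, with pressure P, of the static Euler equations
      (u . grad) u + grad P = 0,  div u = 0
    in the strip. *)
Definition static_euler_solution (R : realType) (L1 L2 : R)
    (u : 'rV[R]_3 -> 'rV[R]_3) (P : 'rV[R]_3 -> R) : Prop :=
  [/\ class_C 1 (strip L1 L2) P,
      (forall i : 'I_3, class_C 1 (strip L1 L2) (fun x => u x 0 i)),
      (forall x, strip L1 L2 x ->
         forall i : 'I_3, convection u i x + partial i P x = 0) &
      (forall x, strip L1 L2 x -> divergence u x = 0)].

(** Absence of a Prandtl layer as nu -> 0+: on every time interval [0, T], the
    viscous flow converges to the inviscid one uniformly in the whole strip,
    walls included.  A boundary layer is precisely a failure of this uniformity
    near the walls. *)
Definition no_prandtl_layer (R : realType) (L1 L2 : R)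
    (u : R -> R -> 'rV[R]_3 -> 'rV[R]_3) (v : 'rV[R]_3 -> 'rV[R]_3) : Prop :=
  forall T : R, 0 <= T ->
    {uniform [set p : R * 'rV[R]_3 | 0 <= p.1 <= T /\ closed_strip L1 L2 p.2],
      (fun (nu : R) (p : R * 'rV[R]_3) => u nu p.1 p.2) @ 0^'+ -->
      (fun p : R * 'rV[R]_3 => v p.2)}.

(* Main.v *)
Require Import Defs.
From HB Require Import structures.
From mathcomp Require Import all_boot all_order all_algebra.
From mathcomp Require Import all_classical all_reals all_analysis.
From mathcomp Require Import ring lra.
Import Order.TTheory GRing.Theory Num.Theory.
Import numFieldNormedType.Exports.
Set Implicit Arguments.
Unset Strict Implicit.
Unset Printing Implicit Defensive.
Local Open Scope classical_set_scope.
Local Open Scope ring_scope.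

(** Write w = d_xi phi.  The velocity (- d_2 phi, d_1 phi, 0), evaluated
    along (t, x1 + x2, x3), is the shear flow (- w, w, 0).  Its speed
    depends on x1 and x2 through x1 + x2 only, so it is divergence free and
    its convection term vanishes identically ([shear_divergence],
    [shear_convection]).  With zero pressure the Euler equations are
    therefore satisfied by the initial field, and the Navier-Stokes
    equations reduce to the heat equation for w.  The latter follows from
    the one for phi by differentiation in xi ([heat_equation_partial]), once
    mixed derivatives are known to commute ([derive_comm]); differentiation
    in xi, a direction tangential to the walls, also preserves the boundary
    condition and the periodicity.

    There is no boundary layer because the initial value w0 of w already
    vanishes on the walls.  Quantitatively, w0 is periodic and uniformly
    continuous, so for every e there is a K such that, whatever the centre
    p, w0 q <= w0 p + e + K |q - p| ^ 2 ([initial_modulus]).  The paraboloid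
    w0 p + e + K |q - p| ^ 2 + 7 nu K t is a strict supersolution of the
    heat equation, it dominates w at time 0, and it dominates w = 0 on the
    walls since it does so at time 0.  The maximum principle
    ([heat_comparison]) then gives w (t, p) <= w0 p + e + 7 nu K t; the same
    argument for - w gives the opposite bound ([heat_flow_near_initial]).
    As K depends on w0 and e only, w tends to w0 with nu, uniformly on [0,
    T] and up to the walls; pointwise convergence is a special case. *)

(** * Directional derivatives along lines *)

(** A directional derivative only sees the restriction of the function to
    one line, so it can be transported between functions on different
    spaces.  All changes of variables below are instances, so that the
    existence of partial derivatives is enough to differentiate composites. *)
Lemma eq_derivable_lines (R : numFieldType) (V V' W : normedModType R)
    (f : V -> W) (g : V' -> W) (x v : V) (y w : V') :
  (forall h : R, f (h *: v + x) = g (h *: w + y)) ->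
  derivable f x v -> derivable g y w.
Proof.
move=> fg; rewrite /derivable.
set F := (X in cvg (X @ _)); set G := (X in _ -> cvg (X @ _)).
suff -> : F = G by [].
apply/funext => h; rewrite /F /G /= fg.
by move: (fg 0); rewrite !scale0r !add0r => ->.
Qed.

Lemma eq_derive_lines (R : numFieldType) (V V' W : normedModType R)
    (f : V -> W) (g : V' -> W) (x v : V) (y w : V') :
  (forall h : R, f (h *: v + x) = g (h *: w + y)) -> 'D_v f x = 'D_w g y.
Proof.
move=> fg; rewrite /derive.
set F := (X in lim (X @ _)); set G := (X in _ = lim (X @ _)).
suff -> : F = G by [].
apply/funext => h; rewrite /F /G /= fg.
by move: (fg 0); rewrite !scale0r !add0r => ->.
Qed.

(** When f is not derivable, the two difference quotients diverge together
    and both derivatives are 0 by convention.  Covering this case lets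
    [partialN] hold as an equality of functions, which can be rewritten
    under a second [partial]. *)
Lemma deriveN_total (R : realType) (V : normedModType R) (f : V -> R)
    (x v : V) : 'D_v (fun y => - f y) x = - 'D_v f x.
Proof.
have [df|ndf] := pselect (derivable f x v); first exact: deriveN.
have ndNf : ~ derivable (fun y => - f y) x v.
  move=> /derivableN; rewrite (_ : - _ = f)//.
  by apply/funext => y; rewrite /GRing.opp /= opprK.
by rewrite /derive (dvgP ndf) (dvgP ndNf) oppr0.
Qed.

Lemma is_derive_line (R : realType) (V : normedModType R) (f : V -> R)
    (x u : V) (s : R) : derivable f (s *: u + x) u ->
  is_derive s 1 (fun r : R => f (r *: u + x)) ('D_u f (s *: u + x)).
Proof.
have E (h : R) : f (h *: u + (s *: u + x)) = f ((h *: (1 : R) + s) *: u + x).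
  by rewrite [h *: (1 : R)]mulr1 scalerDl addrA.
move=> df; apply: DeriveDef.
  by apply: eq_derivable_lines df => h; exact: E.
by apply/esym/eq_derive_lines => h; exact: E.
Qed.

Lemma MVT_line (R : realType) (V : normedModType R) (f : V -> R)
    (x u : V) (h : R) : 0 <= h ->
  (forall s, 0 <= s <= h -> derivable f (s *: u + x) u) ->
  exists2 c, 0 <= c <= h & f (h *: u + x) - f x = 'D_u f (c *: u + x) * h.
Proof.
move=> h0 df.
have [||c ch] := @MVT_segment R (fun r => f (r *: u + x))
    (fun r => 'D_u f (r *: u + x)) 0 h h0.
- move=> s /[!in_itv]/= /andP[s0 sh]; apply: is_derive_line.
  by apply: df; rewrite !ltW.
- apply: derivable_within_continuous => s /[!in_itv]/= sh.
  by have [] := is_derive_line (df s sh).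
- by rewrite scale0r add0r subr0 => E; exists c; rewrite // -in_itv.
Qed.

(** The mean value theorem applied first to y |-> f (h v + y) - f y along u,
    then to the resulting increment of 'D_u f along v.  The left-hand side
    is symmetric in u and v, which is what makes mixed derivatives commute. *)
Lemma rectangle_increment (R : realType) (V : normedModType R) (f : V -> R)
    (A : set V) (x u v : V) (h : R) : 0 <= h ->
  (forall a b, 0 <= a <= h -> 0 <= b <= h -> A (b *: v + (a *: u + x))) ->
  (forall y, A y -> derivable f y u) ->
  (forall y, A y -> derivable ('D_u f) y v) ->
  exists a b, [/\ 0 <= a <= h, 0 <= b <= h &
    f (h *: v + (h *: u + x)) - f (h *: u + x) - f (h *: v + x) + f x
    = 'D_v ('D_u f) (b *: v + (a *: u + x)) * h ^+ 2].
Proof.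
move=> h0 hA du dvu.
have hh : 0 <= h <= h by rewrite h0 lexx.
have h00 : 0 <= (0 : R) <= h by rewrite lexx.
pose g y := f (h *: v + y) - f y.
have dT s : 0 <= s <= h ->
    is_derive (s *: u + x) u (fun y => f (h *: v + y))
      ('D_u f (h *: v + (s *: u + x))).
  move=> sh; have E (k : R) : f (k *: u + (h *: v + (s *: u + x))) =
      f (h *: v + (k *: u + (s *: u + x))).
    by congr f; rewrite addrCA.
  apply: DeriveDef; last by apply/esym/eq_derive_lines.
  by apply: (eq_derivable_lines E); apply: du; exact: hA.
have d0 s : 0 <= s <= h -> derivable f (s *: u + x) u.
  by move=> sh; apply: du; have := hA _ _ sh h00; rewrite scale0r add0r.
have dg s : 0 <= s <= h -> is_derive (s *: u + x) u g
    ('D_u f (h *: v + (s *: u + x)) - 'D_u f (s *: u + x)).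
  move=> sh; have /derivableP d1 := d0 _ sh; have d2 := dT _ sh.
  exact: is_deriveB.
have [|a ah gE] := @MVT_line R V g x u h h0.
  by move=> s sh; have [] := dg s sh.
have [|b bh fE] := @MVT_line R V ('D_u f) (a *: u + x) v h h0.
  by move=> s sh; apply: dvu; exact: hA.
exists a, b; split => //.
have [_ dgE] := dg a ah.
move: gE; rewrite dgE fE /g.
move=> E; rewrite expr2 mulrA -E; ring.
Qed.

(** Schwarz's theorem.  Both mixed derivatives are taken at some point of an
    arbitrarily small parallelogram at x, where by [rectangle_increment]
    they equal the same second difference divided by h ^ 2; continuity at x
    concludes. *)
Lemma derive_comm (R : realType) (V : normedModType R) (f : V -> R)
    (A : set V) (u v x : V) : open A -> A x ->
  (forall y, A y -> derivable f y u) ->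
  (forall y, A y -> derivable f y v) ->
  (forall y, A y -> derivable ('D_u f) y v) ->
  (forall y, A y -> derivable ('D_v f) y u) ->
  {for x, continuous ('D_v ('D_u f))} -> {for x, continuous ('D_u ('D_v f))} ->
  'D_v ('D_u f) x = 'D_u ('D_v f) x.
Proof.
move=> oA Ax du dv duv dvu cuv cvu.
apply/eqP; rewrite -subr_eq0 -normr_eq0 eq_le normr_ge0 andbT.
apply/ler_addgt0Pr => e e0; rewrite add0r.
have tri (p q s : R) : `|p - q| < e / 2 -> `|s - q| < e / 2 -> `|p - s| <= e.
  move=> /ltW pq /ltW sq; rewrite [leRHS]splitr.
  by rewrite -(subrKA q) (le_trans (ler_normD _ _))// (distrC q) lerD.
have e20 : 0 < e / 2 by rewrite divr_gt0.
have nb : \forall y \near x, [/\ A y,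
    `|'D_v ('D_u f) x - 'D_v ('D_u f) y| < e / 2 &
    `|'D_u ('D_v f) x - 'D_u ('D_v f) y| < e / 2].
  have nA : \forall y \near x, A y by exact: open_nbhs_nbhs.
  have n1 : \forall y \near x, `|'D_v ('D_u f) x - 'D_v ('D_u f) y| < e / 2.
    by move/cvgrPdist_lt: cuv; apply.
  have n2 : \forall y \near x, `|'D_u ('D_v f) x - 'D_u ('D_v f) y| < e / 2.
    by move/cvgrPdist_lt: cvu; apply.
  by apply: filterS3 nA n1 n2 => y.
move: nb => /nbhs_normP[r /= r0 rA].
(* The summand 1 keeps M positive when u = v = 0. *)
pose M := `|u| + `|v| + 1.
have M0 : 0 < M by rewrite ltr_wpDl.
pose h := r / 2 / M.
have h0 : 0 < h by rewrite !divr_gt0.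
have box a b : 0 <= a <= h -> 0 <= b <= h ->
    ball_ Num.norm x r (b *: v + (a *: u + x)).
  move=> /andP[a0 ah] /andP[b0 bh]; rewrite /ball_ /=.
  rewrite (_ : x - _ = - (b *: v + a *: u)); last first.
    by rewrite addrA opprD addrCA subrr addr0.
  rewrite normrN (le_lt_trans (ler_normD _ _))// !normrZ !ger0_norm//.
  have : b * `|v| + a * `|u| <= h * M.
    rewrite /M !mulrDr mulr1 [leLHS]addrC ler_wpDr ?(ltW h0)//.
    by rewrite lerD// ler_wpM2r.
  move=> /le_lt_trans; apply.
  by rewrite /h divfK ?gt_eqF// ltr_pdivrMr// ltr_pMr// ltr1n.
have [|a [b [ah bh E1]]] :=
    @rectangle_increment R V f A x u v h (ltW h0) _ du duv.
  by move=> a b ah bh; have [] := rA _ (box a b ah bh).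
have [|c [d [ch dh E2]]] :=
    @rectangle_increment R V f A x v u h (ltW h0) _ dv dvu.
  by move=> c d ch dh; have [] := rA _ (box d c dh ch); rewrite addrCA.
have E : 'D_v ('D_u f) (b *: v + (a *: u + x)) =
         'D_u ('D_v f) (d *: u + (c *: v + x)).
  apply: (mulIf (x := h ^+ 2)); first by rewrite expf_neq0// gt_eqF.
  by apply: (etrans (esym E1)); apply: etrans E2; rewrite (addrCA (h *: v)); ring.
have [_ N1 _] := rA _ (box a b ah bh).
have [_ _] := rA _ (box d c dh ch).
rewrite addrCA -E.
exact: tri N1.
Qed.

(** * Functions of class C^k and changes of variables *)

Lemma class_CW (R : realType) (n k : nat) (A : set 'rV[R]_n.+1)
    (f : 'rV[R]_n.+1 -> R) : class_C k.+1 A f -> class_C k A f.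
Proof.
elim: k f => [|k IH] f [cf df]; split => // j.
by have [dfj Cfj] := df j; split=> //; exact: IH.
Qed.

Lemma class_C_cst (R : realType) (n k : nat) (A : set 'rV[R]_n.+1) (c : R) :
  class_C k A (fun=> c).
Proof.
elim: k c => [|k IH] c; (split; first by move=> x _; exact: cst_continuous) => //= j.
split; first by move=> x _; exact: derivable_cst.
rewrite (_ : partial j _ = fun=> 0); first exact: IH.
by apply/funext => x; exact: derive_cst.
Qed.

Lemma partialN (R : realType) (n : nat) (j : 'I_n.+1) (f : 'rV[R]_n.+1 -> R) :
  partial j (fun x => - f x) = fun x => - partial j f x.
Proof. by apply/funext => x; exact: deriveN_total. Qed.

Lemma class_CN (R : realType) (n k : nat) (A : set 'rV[R]_n.+1)
    (f : 'rV[R]_n.+1 -> R) : class_C k A f -> class_C k A (fun x => - f x).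
Proof.
elim: k f => [|k IH] f [cf df];
  (split; first by move=> x Ax; exact: (cvgN (cf x Ax))); first by [].
move=> j; have [dfj Cfj] := df j; split.
  by move=> x Ax; apply: derivableN; exact: dfj.
by rewrite partialN; exact: IH.
Qed.

(** Maps sending each line parallel to an axis onto a line parallel to an
    axis, at unit speed.  Both substitutions of the problem, (x1, x2, x3)
    |-> (t, x1 + x2, x3) and (x1, x2, x3) |-> (x1 + x2, x3), are of this
    kind, so partial derivatives of composites are again partial
    derivatives. *)
Definition axis_map (R : realType) (m n : nat)
    (L : 'rV[R]_m.+1 -> 'rV[R]_n.+1) (s : 'I_m.+1 -> 'I_n.+1) : Prop :=
  forall j (h : R) x, L (h *: delta_mx 0 j + x) = h *: delta_mx 0 (s j) + L x.

Lemma partial_axis_map (R : realType) (m n : nat)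
    (L : 'rV[R]_m.+1 -> 'rV[R]_n.+1) s (f : 'rV[R]_n.+1 -> R) j :
  axis_map L s -> partial j (f \o L) = partial (s j) f \o L.
Proof.
by move=> Ls; apply/funext => x; apply: eq_derive_lines => h /=; rewrite Ls.
Qed.

Lemma class_C_axis_map (R : realType) (m n k : nat)
    (L : 'rV[R]_m.+1 -> 'rV[R]_n.+1) s (f : 'rV[R]_n.+1 -> R)
    (A : set 'rV[R]_m.+1) (B : set 'rV[R]_n.+1) :
  axis_map L s -> continuous L -> (forall x, A x -> B (L x)) ->
  class_C k B f -> class_C k A (f \o L).
Proof.
move=> Ls cL AB; elim: k f => [|k IH] f [cf df];
  (split; first by
    move=> x Ax; apply: continuous_comp; [exact: cL | exact: cf (AB _ Ax)]);
  first by [].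
move=> j; have [dfj Cfj] := df (s j); split; last first.
  by rewrite (partial_axis_map _ _ Ls); exact: IH.
move=> x Ax; apply: eq_derivable_lines (dfj _ (AB _ Ax)) => h /=.
by rewrite Ls.
Qed.

Lemma partial_comm (R : realType) (n : nat) (A : set 'rV[R]_n.+1)
    (f : 'rV[R]_n.+1 -> R) (i j : 'I_n.+1) (x : 'rV[R]_n.+1) :
  open A -> class_C 2 A f -> A x ->
  partial i (partial j f) x = partial j (partial i f) x.
Proof.
move=> oA [_ Cf] Ax; have [dfi [_ Ci]] := Cf i; have [dfj [_ Cj]] := Cf j.
have [dji [cji _]] := Cj i; have [dij [cij _]] := Ci j.
exact: (derive_comm oA Ax dfj dfi dji dij (cji x Ax) (cij x Ax)).
Qed.

(** * Derivatives at a maximum *)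

(** The touching condition is asked on the left only: at the final time of a
    parabolic box the function can be compared with earlier times only. *)
Lemma derive_ge_max_left (R : realType) (f : R -> R) (a t kappa : R) : a < t ->
  derivable f t 1 ->
  (forall s, a < s < t -> f s <= f t + kappa * (s - t)) -> kappa <= 'D_1 f t.
Proof.
move=> aT df fle.
rewrite ['D_1 f t](cvg_at_leftE _ _ df); apply: limr_ge.
  have := df; rewrite -(cvg_at_leftE (fun h => h^-1 *: ((f \o shift t) _ - f t))) //.
  move=> dft; apply: cvg_trans dft; apply: cvg_app.
  move=> A [e egt0 Ae]; exists e => // x xe xgt0; apply: Ae => //.
  exact/ltr0_neq0.
near=> h.
have h0 : h < 0 by near: h; exact: nbhs_left_lt.
have ha : a - t < h by near: h; apply: nbhs_left_gt; rewrite subr_lt0.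
rewrite /= [h *: 1]mulr1 /GRing.scale /= -ler_ndivlMl ?invr_lt0// invrK.
have := fle (h + t); lra.
Unshelve. all: by end_near. Qed.

(** Subtracting the parabola leaves a function g with a maximum at x, so g'
    x = 0.  If g'' x were positive, g' would be positive just to the right
    of x and g would increase there by the mean value theorem. *)
Lemma derive2_le_max (R : realType) (f df : R -> R) (a b x p K d2 : R) :
  a < x < b -> (forall y, a < y < b -> is_derive y 1 f (df y)) ->
  is_derive x 1 df d2 ->
  (forall y, a < y < b -> f y <= f x + p * (y - x) + K * (y - x) ^+ 2) ->
  d2 <= 2 * K.
Proof.
move=> /andP[ax xb] fdf dfd2 fle.
pose g y := f y - (p * (y - x) + K * (y - x) ^+ 2).
pose dg y := df y - (p + 2 * K * (y - x)).
have gdg y : a < y < b -> is_derive y 1 g (dg y).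
  move=> /fdf fy; rewrite /g /dg; apply: is_deriveB.
  rewrite (_ : (fun _ => _) = (p \*: (id - cst x) + K \*: ((id - cst x) ^+ 2))).
    apply: is_derive_eq; rewrite /= !subr0 expr1 /GRing.scale /=.
    by have -> : (id - cst x) y = y - x by []; ring.
  by apply/funext.
have dgd2 : is_derive x 1 dg (d2 - 2 * K).
  apply: is_deriveB.
  rewrite (_ : (fun _ => _) = (cst p + (2 * K) \*: (id - cst x))).
    by apply: is_derive_eq; rewrite subr0 /GRing.scale /=; ring.
  by apply/funext.
have dgx0 : dg x = 0.
  have xab : x \in `]a, b[%R by rewrite in_itv /= ax.
  have [_ <-] := gdg x (introT andP (conj ax xb)).
  have [] // := @derive1_at_max _ g a b x (ltW (lt_trans ax xb)) _ xab.
    by move=> y /[!in_itv] /= /gdg[].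
  move=> y /[!in_itv] /= /fle; rewrite /g subrr; lra.
rewrite leNgt; apply/negP => K2.
have [dd dE] := dgd2.
have /(cvgr_gt (d2 - 2 * K)) H : (fun h => h^-1 *: ((dg \o shift x) (h *: 1) - dg x)) @ 0^' --> d2 - 2 * K.
  by rewrite -dE; exact: dd.
have {H} /= := H 0; rewrite subr_gt0 => /(_ K2).
move=> -[r /= r0 rP].
(* c stays in the interval and in the ball where g' > 0 on the right of x. *)
pose c := Num.min (x + r / 2) ((x + b) / 2).
have xc : x < c by rewrite /c lt_min; apply/andP; split; lra.
have cr : c < x + r by rewrite /c gt_min; apply/orP; left; lra.
have cb : c < b by rewrite /c gt_min; apply/orP; right; lra.
have sub y : y \in `[x, c]%R -> a < y < b.
  rewrite in_itv /= => /andP[xy yc].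
  by rewrite (lt_le_trans ax xy) (le_lt_trans yc cb).
have [||y /[!in_itv] /= /andP[xy yc] gE] := @MVT R g dg x c xc.
- by move=> y yxc; apply: gdg; apply: sub; exact: subset_itv_oo_cc yxc.
- by apply: derivable_within_continuous => y /sub /gdg[].
have dgy : 0 < dg y.
  have yx0 : 0 < y - x by rewrite subr_gt0.
  have : ball_ Num.norm 0 r (y - x) by rewrite /ball_ /= distrC subr0 gtr0_norm//; lra.
  move=> /rP/(_ (lt0r_neq0 yx0)) /=.
  by rewrite dgx0 subr0 [_ *: 1]mulr1 subrK /GRing.scale /= pmulr_rgt0 ?invr_gt0.
have : 0 < g c - g x by rewrite gE mulr_gt0// subr_gt0.
have : a < c < b by rewrite (lt_trans ax xc).
by move=> /fle; rewrite /g subrr; lra.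
Qed.

(** * Maximum principle for the heat equation *)

Definition box (R : realType) (n : nat) (lo hi : 'rV[R]_n.+1) :
  set 'rV[R]_n.+1 := [set p | forall i, lo 0 i <= p 0 i <= hi 0 i].

Lemma compact_box (R : realType) (n : nat) (lo hi : 'rV[R]_n.+1) :
  compact (box lo hi).
Proof.
have := @rV_compact R n.+1 (fun i => `[lo 0 i, hi 0 i]%classic)
  (fun i => @segment_compact R _ _).
by congr compact; apply/seteqP; split => p + i => /(_ i) /=; rewrite in_itv.
Qed.

Lemma forall_I3 (P : 'I_3 -> Prop) : P 0 -> P 1 -> P 2 -> forall i, P i.
Proof.
move=> P0 P1 P2 [[|[|[|//]]] i3].
- by have <- : 0 = Ordinal i3 by apply/val_inj.
- by have <- : 1 = Ordinal i3 by apply/val_inj.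
- by have <- : 2 = Ordinal i3 by apply/val_inj.
Qed.

Lemma vec3E (R : realType) (a b c : R) :
  (vec3 a b c 0 0 = a) * (vec3 a b c 0 1 = b) * (vec3 a b c 0 2 = c).
Proof. by rewrite /vec3 !mxE. Qed.

Lemma box3P (R : realType) (a0 a1 a2 b0 b1 b2 : R) (p : 'rV[R]_3) :
  box (vec3 a0 a1 a2) (vec3 b0 b1 b2) p <->
  [/\ a0 <= p 0 0 <= b0, a1 <= p 0 1 <= b1 & a2 <= p 0 2 <= b2].
Proof.
split=> [bp|[p0 p1 p2]]; last by apply: forall_I3; rewrite !vec3E.
by move: (bp 0) (bp 1) (bp 2); rewrite !vec3E.
Qed.

Lemma line_coord (R : realType) (n : nat) (h : R) (j i : 'I_n) (p : 'rV[R]_n) :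
  (h *: delta_mx 0 j + p) 0 i = h *+ (i == j) + p 0 i.
Proof. by rewrite !mxE eqxx /= mulr_natr. Qed.

(** A paraboloid centred at z, rising in time at speed kappa; for kappa > 6
    nu K it is a strict supersolution of the heat equation, because (2
    d_xi^2 + d_eta^2) of K |.|^2 is 6 K. *)
Definition barrier (R : realType) (c K kappa : R) (z p : 'rV[R]_3) : R :=
  c + K * ((p 0 1 - z 0 1) ^+ 2 + (p 0 2 - z 0 2) ^+ 2) + kappa * p 0 0.

Lemma barrier_continuous (R : realType) (c K kappa : R) (z : 'rV[R]_3) :
  continuous (barrier c K kappa z).
Proof.
have cc i : continuous (fun p : 'rV[R]_3 => p 0 i) by exact: coord_continuous.
have sq i : continuous (fun p : 'rV[R]_3 => (p 0 i - z 0 i) ^+ 2).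
  move=> p; apply: (@continuous_comp _ _ _ (fun p : 'rV[R]_3 => p 0 i - z 0 i)
    (fun x => x ^+ 2)); last exact: exprn_continuous.
  by apply: continuousB; [exact: cc|exact: cst_continuous].
move=> p; have cst (k : R) : {for p, continuous (fun=> k)}.
  exact: cst_continuous.
exact: (continuousD (continuousD (cst c)
  (continuousM (cst K) (continuousD (sq 1 p) (sq 2 p))))
  (continuousM (cst kappa) (cc 0 p))).
Qed.

Lemma derive2_axis_le_max (R : realType) (n : nat) (A : set 'rV[R]_n.+1)
    (w : 'rV[R]_n.+1 -> R) (j : 'I_n.+1) (q : 'rV[R]_n.+1) (a b p K : R) :
  class_C 2 A w -> a < 0 < b ->
  (forall h, a < h < b -> A (h *: delta_mx 0 j + q)) ->
  (forall h, a < h < b ->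
     w (h *: delta_mx 0 j + q) <= w q + p * h + K * h ^+ 2) ->
  partial j (partial j w) q <= 2 * K.
Proof.
move=> [_ Cw] ab lineA wle; have [dw [_ Cjw]] := Cw j; have [djw _] := Cjw j.
apply: (@derive2_le_max _ (fun h => w (h *: delta_mx 0 j + q))
  (fun h => partial j w (h *: delta_mx 0 j + q)) a b 0 p).
- exact: ab.
- by move=> h /lineA/dw; exact: is_derive_line.
- have := @is_derive_line _ _ (partial j w) q (delta_mx 0 j) 0.
  by rewrite scale0r add0r; apply; have := djw _ (lineA _ ab); rewrite scale0r add0r.
- by move=> h /wle; rewrite scale0r add0r subr0.
Qed.

(** Maximum principle.  If w minus the barrier had a positive maximum over
    Q, that maximum could not lie on the bottom or the lateral faces; at it,
    d_t w >= kappa while d_xi^2 w and d_eta^2 w are at most 2 K, so the heat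
    equation would give kappa <= 6 nu K.  The top face t = T is allowed,
    thanks to the one-sided [derive_ge_max_left]. *)
Lemma heat_comparison (R : realType) (nu L1 L2 T rho c K kappa : R)
    (z : 'rV[R]_3) (w : 'rV[R]_3 -> R) :
  let Q := box (vec3 0 (z 0 1 - rho) L1) (vec3 T (z 0 1 + rho) L2) in
  0 < nu -> 6 * nu * K < kappa ->
  {within Q, continuous w} ->
  class_C 2 (open_domain L1 L2) w ->
  (forall p, open_domain L1 L2 p ->
     partial 0 w p - nu * (2 * partial 1 (partial 1 w) p
                           + partial 2 (partial 2 w) p) = 0) ->
  (forall p, Q p -> p 0 0 = 0 -> w p <= barrier c K kappa z p) ->
  (forall p, Q p -> `|p 0 1 - z 0 1| = rho -> w p <= barrier c K kappa z p) ->
  (forall p, Q p -> p 0 2 = L1 \/ p 0 2 = L2 ->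
     w p <= barrier c K kappa z p) ->
  forall p, Q p -> w p <= barrier c K kappa z p.
Proof.
move=> Q nu0 Kk cw Cw heat init sides walls p Qp.
have cg : {within Q, continuous (fun p => w p - barrier c K kappa z p)}.
  move=> x; apply: continuousB; first exact: cw.
  by apply: continuous_subspaceT; exact: barrier_continuous.
have [|q /set_mem Qq qmax] := EVT_max_rV _ (@compact_box _ _ _ _) cg.
  by exists p.
rewrite leNgt; apply/negP => wp.
have wq : barrier c K kappa z q < w q.
  by have := qmax p (mem_set Qp); lra.
have {}qmax r : Q r ->
    w r <= w q + (barrier c K kappa z r - barrier c K kappa z q).
  by move=> Qr; have := qmax r (mem_set Qr); lra.
have [/andP[t0 tT] /andP[x0 x1] /andP[y0 y1]] := (box3P _ _ _ _ _ _ _).1 Qq.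
have {}t0 : 0 < q 0 0.
  by rewrite lt_neqAle t0 andbT; apply/eqP => /esym/(init _ Qq); lra.
have {}y0 : L1 < q 0 2.
  rewrite lt_neqAle y0 andbT; apply/eqP => E.
  by have := walls _ Qq (or_introl (esym E)); lra.
have {}y1 : q 0 2 < L2.
  rewrite lt_neqAle y1 andbT; apply/eqP => E.
  by have := walls _ Qq (or_intror E); lra.
have {x0 x1}/andP[x0 x1] : z 0 1 - rho < q 0 1 < z 0 1 + rho.
  have : `|q 0 1 - z 0 1| < rho; last by rewrite ltr_norml; lra.
  rewrite lt_neqAle; apply/andP; split; last by rewrite ler_norml; lra.
  by apply/eqP => /(sides _ Qq); lra.
have oq : open_domain L1 L2 q by split => //; apply/andP.
have dt : kappa <= partial 0 w q.
  have [_ Cw0] := Cw; have [dw _] := Cw0 0.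
  have := @is_derive_line _ _ w q (delta_mx 0 0) 0.
  rewrite scale0r add0r => /(_ (dw _ oq)) [df dfE].
  rewrite /partial -dfE.
  apply: (@derive_ge_max_left _ _ (- q 0 0)) => //; first by rewrite oppr_lt0.
  move=> h /andP[hq h0]; rewrite scale0r add0r subr0.
  have /qmax : Q (h *: delta_mx 0 0 + q).
    by apply/box3P; rewrite !line_coord /= !add0r; split; apply/andP; split; lra.
  by rewrite /barrier !line_coord /= !add0r; lra.
have dx : partial 1 (partial 1 w) q <= 2 * K.
  apply: (@derive2_axis_le_max _ _ _ w 1 q (z 0 1 - rho - q 0 1)
    (z 0 1 + rho - q 0 1) (2 * K * (q 0 1 - z 0 1)) _ Cw).
  - by apply/andP; split; lra.
  - by move=> h _; rewrite /open_domain /= !line_coord /= !add0r.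
  - move=> h /andP[h0 h1]; have /qmax : Q (h *: delta_mx 0 1 + q).
      by apply/box3P; rewrite !line_coord /= !add0r; split; apply/andP; split; lra.
    rewrite /barrier !line_coord /= !add0r => /le_trans; apply.
    by rewrite -subr_ge0 le_eqVlt; apply/orP; left; apply/eqP; ring.
have dy : partial 2 (partial 2 w) q <= 2 * K.
  apply: (@derive2_axis_le_max _ _ _ w 2 q (L1 - q 0 2) (L2 - q 0 2)
    (2 * K * (q 0 2 - z 0 2)) _ Cw).
  - by apply/andP; split; lra.
  - move=> h /andP[h0 h1]; rewrite /open_domain /= !line_coord /= !add0r.
    by split => //; apply/andP; split; lra.
  - move=> h /andP[h0 h1]; have /qmax : Q (h *: delta_mx 0 2 + q).
      by apply/box3P; rewrite !line_coord /= !add0r; split; apply/andP; split; lra.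
    rewrite /barrier !line_coord /= !add0r => /le_trans; apply.
    by rewrite -subr_ge0 le_eqVlt; apply/orP; left; apply/eqP; ring.
move: (heat q oq) dt dx dy Kk nu0; clear.
move: (partial 0 w q) (partial 1 _ q) (partial 2 _ q) => a b d E ka bK dK Kk nu0.
have : nu * (2 * b + d) <= nu * (6 * K) by rewrite ler_pM2l//; lra.
lra.
Qed.

(** * Uniform continuity *)

(** Heine's theorem, by a near-covering argument: around each point of K,
    half the radius given by continuity for e / 2 works for all pairs close
    to it. *)
Lemma compact_uniform_continuous (R : realType) (X : pseudoMetricType R)
    (K : set X) (f : X -> R) : compact K -> {within K, continuous f} ->
  forall e, 0 < e -> exists2 d, 0 < d &
    forall x y, K x -> K y -> ball x d y -> `|f x - f y| < e.
Proof.
move=> /compact_near_coveringP cK cf e e0.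
have e20 : 0 < e / 2 by rewrite divr_gt0.
have := cK R 0^'+ (fun d x => forall y, K x -> K y -> ball x d y ->
  `|f x - f y| < e) _.
case=> [x Kx|r /= r0 rP]; last first.
  have r20 : 0 < r / 2 by rewrite divr_gt0.
  exists (r / 2) => // x y Kx; apply: (rP (r / 2)) => //=.
  by rewrite distrC subr0 gtr0_norm// ltr_pdivrMr// ltr_pMr// ltr1n.
have : \forall y \near x, K y -> `|f x - f y| < e / 2.
  have /cvgrPdist_lt/(_ _ e20) := (subspace_continuousP K f).1 cf x Kx.
  by rewrite near_withinE.
move=> /nbhs_ballP[r /= r0 rP].
have r20 : 0 < r / 2 by rewrite divr_gt0.
exists (ball x (r / 2), [set d | d < r / 2]) => /=.
  by split; [exact: nbhsx_ballx|exact: nbhs_right_lt].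
move=> -[x' d] /= [xx' dr] y Kx' Ky x'y.
have rx' : ball x r x' by apply: le_ball xx'; rewrite ler_pdivrMr// ler_pMr// ler1n.
have ry : ball x r y.
  by rewrite [r]splitr; apply: ball_triangle xx' (le_ball (ltW dr) x'y).
rewrite -(subrKA (f x)) (le_lt_trans (ler_normD _ _))// [ltRHS]splitr.
by rewrite distrC ltrD// rP.
Qed.

(** * Heat flows at small viscosity *)

(** The properties of the tangential derivative w = d_xi phi on which both
    the Navier-Stokes equations and the absence of a layer rest: w solves
    the same boundary value problem as phi, one derivative less regular. *)
Definition heat_flow (R : realType) (nu L1 L2 : R) (w : 'rV[R]_3 -> R) : Prop :=
  [/\ class_C 2 (open_domain L1 L2) w,
      {within closed_domain L1 L2, continuous w},
      (forall p, open_domain L1 L2 p ->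
         partial 0 w p - nu * (2 * partial 1 (partial 1 w) p
                               + partial 2 (partial 2 w) p) = 0),
      (forall p, closed_domain L1 L2 p -> p 0 2 = L1 \/ p 0 2 = L2 ->
         w p = 0) &
      (forall p, closed_domain L1 L2 p ->
         w ((2 * pi) *: delta_mx 0 1 + p) = w p)].

Lemma heat_flowN (R : realType) (nu L1 L2 : R) (w : 'rV[R]_3 -> R) :
  heat_flow nu L1 L2 w -> heat_flow nu L1 L2 (fun p => - w p).
Proof.
case=> Cw cw heat wall per; split.
- exact: class_CN.
- by move=> p; apply: cvgN; exact: cw.
- move=> p /heat; rewrite !partialN.
  move: (partial 0 w p) (partial 1 _ p) (partial 2 _ p) => a b c.
  by move=> /eqP; rewrite -oppr_eq0 => /eqP <-; ring.
- by move=> p /wall H /H ->; rewrite oppr0.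
- by move=> p /per ->.
Qed.

Lemma closed_domain_shift (R : realType) (L1 L2 s : R) (p : 'rV[R]_3) :
  closed_domain L1 L2 (s *: delta_mx 0 1 + p) <-> closed_domain L1 L2 p.
Proof. by rewrite /closed_domain /= !line_coord /= !add0r. Qed.

(** One shift s, independent of the function, brings xi into [0, 2 pi]; the
    independence lets two points be shifted together in [initial_modulus]. *)
Lemma shift_to_period (R : realType) (L1 L2 xi : R) : exists s : R,
  0 <= s + xi <= 2 * pi /\
  forall w : 'rV[R]_3 -> R,
    (forall p, closed_domain L1 L2 p ->
       w ((2 * pi) *: delta_mx 0 1 + p) = w p) ->
    forall p, closed_domain L1 L2 p -> w (s *: delta_mx 0 1 + p) = w p.
Proof.
have tp0 : 0 < 2 * pi :> R by rewrite mulr_gt0// pi_gt0.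
set T := 2 * pi in tp0 *; pose m := Num.floor (xi / T).
exists (- (m%:~R * T)); split.
  have := floor_le (xi / T); have := floorD1_gt (xi / T); rewrite -/m.
  rewrite ler_pdivlMr// ltr_pdivrMr// intrD mulrDl mul1r => m2 m1.
  by apply/andP; split; lra.
move=> w per.
have pern (n : nat) p : closed_domain L1 L2 p ->
    w ((n%:R * T) *: delta_mx 0 1 + p) = w p.
  elim: n p => [|n IH] p Dp; first by rewrite mul0r scale0r add0r.
  rewrite -natr1 mulrDl mul1r scalerDl -addrA IH ?per//.
  by apply/closed_domain_shift.
move=> p Dp; case: m => n.
  rewrite -(pern n); last by apply/closed_domain_shift.
  by rewrite addrA -scalerDl subrr scale0r add0r.
by rewrite NegzE mulrNz mulNr opprK; exact: pern.
Qed.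

(** Up to time T a periodic function is determined by its values on a
    compact box. *)
Lemma periodic_bounded (R : realType) (L1 L2 T : R) (w : 'rV[R]_3 -> R) :
  {within closed_domain L1 L2, continuous w} ->
  (forall p, closed_domain L1 L2 p ->
     w ((2 * pi) *: delta_mx 0 1 + p) = w p) ->
  exists M : R, forall p, closed_domain L1 L2 p -> p 0 0 <= T -> `|w p| <= M.
Proof.
move=> cw per.
pose Q := box (vec3 0 0 L1) (vec3 T (2 * pi) L2).
have QD : Q `<=` closed_domain L1 L2.
  by move=> p /box3P[/andP[p0 _] _ p2].
have shiftQ p : closed_domain L1 L2 p -> p 0 0 <= T ->
    exists2 q, Q q & w q = w p.
  move=> Dp pT; have [s [sp sw]] := shift_to_period L1 L2 (p 0 1).
  exists (s *: delta_mx 0 1 + p); last exact: sw.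
  case: Dp => p0 p2.
  by apply/box3P; rewrite !line_coord /= !add0r p0 pT sp.
have [[p Qp]|Q0] := pselect (Q !=set0); last first.
  exists 0 => p Dp pT; exfalso; apply: Q0.
  by have [q Qq _] := shiftQ p Dp pT; exists q.
have cwQ : {within Q, continuous (fun p => `|w p|)}.
  move=> x; apply: cvg_norm; exact: (continuous_subspaceW QD cw).
have [|q _ qmax] := EVT_max_rV _ (@compact_box _ _ _ _) cwQ.
  by exists p.
exists `|w q| => r Dr rT.
by have [r' Qr' <-] := shiftQ r Dr rT; apply: qmax; exact: mem_set.
Qed.

(** Nearby points are handled by uniform continuity, which bounds the
    difference by e; distant ones by boundedness, once K is large.  The same
    K serves all centres p, by periodicity. *)
Lemma initial_modulus (R : realType) (L1 L2 : R) (w : 'rV[R]_3 -> R) (e : R) :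
  {within closed_domain L1 L2, continuous w} ->
  (forall p, closed_domain L1 L2 p ->
     w ((2 * pi) *: delta_mx 0 1 + p) = w p) ->
  0 < e ->
  exists2 K : R, 0 < K & forall p q, closed_domain L1 L2 p ->
    closed_domain L1 L2 q -> p 0 0 = 0 -> q 0 0 = 0 ->
    `|w q - w p| <= e + K * ((q 0 1 - p 0 1) ^+ 2 + (q 0 2 - p 0 2) ^+ 2).
Proof.
move=> cw per e0.
have [M Mw] := @periodic_bounded _ L1 L2 0 w cw per.
pose Q := box (vec3 0 (- 1) L1) (vec3 0 (2 * pi + 1) L2).
have QD : Q `<=` closed_domain L1 L2.
  by move=> p /box3P[/andP[p0 _] _ p2].
have [r r0 rw] := @compact_uniform_continuous R _ Q w
  (@compact_box _ _ _ _) (continuous_subspaceW QD cw) e e0.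
(* The bound 1 keeps the shifted second point inside the enlarged box Q. *)
pose d := Num.min r 1.
have d0 : 0 < d by rewrite lt_min r0 ltr01.
have dr : d <= r by rewrite ge_min lexx.
have d1 : d <= 1 by rewrite ge_min lexx orbT.
have d20 : 0 < d ^+ 2 by rewrite exprn_gt0.
(* At distance at least d the term K D alone exceeds the oscillation 2 |M|. *)
exists (2 * `|M| / d ^+ 2 + 1).
  by rewrite ltr_wpDl// divr_ge0// ?mulr_ge0// ltW.
move=> p q Dp Dq p0 q0.
set D := _ ^+ 2 + _ ^+ 2.
have D0 : 0 <= D by rewrite addr_ge0// sqr_ge0.
have [Dd|Dd] := ltP D (d ^+ 2); last first.
  have wp : `|w p| <= `|M| by rewrite (le_trans (Mw _ Dp _)) ?p0// ler_norm.
  have wq : `|w q| <= `|M| by rewrite (le_trans (Mw _ Dq _)) ?q0// ler_norm.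
  rewrite (le_trans (ler_normB _ _))//.
  have : 2 * `|M| <= 2 * `|M| / d ^+ 2 * D.
    by rewrite mulrAC ler_pdivlMr// ler_wpM2l// mulr_ge0.
  rewrite mulrDl mul1r; move: wp wq D0 e0; clear; lra.
apply: (@le_trans _ _ e); last first.
  by rewrite lerDl mulr_ge0// addr_ge0// divr_ge0// ?mulr_ge0// ltW.
have close (x : R) : x ^+ 2 <= D -> `|x| < d.
  move=> xD; rewrite ltNge; apply/negP => dx.
  have : d ^+ 2 <= `|x| ^+ 2 by rewrite ler_pXn2r// nnegrE ltW.
  by rewrite real_normK ?num_real//; move: xD Dd; clear; lra.
have x1 : `|q 0 1 - p 0 1| < d by apply: close; rewrite lerDl sqr_ge0.
have x2 : `|q 0 2 - p 0 2| < d by apply: close; rewrite lerDr sqr_ge0.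
have [s [/andP[s1 s2] sw]] := shift_to_period L1 L2 (p 0 1).
rewrite -(sw w per p Dp) -(sw w per q Dq); apply: ltW.
case: Dp Dq => _ p2 [_ q2].
apply: rw.
- apply/box3P; rewrite !line_coord /= !add0r q0 lexx; split => //.
  by move: x1; rewrite ltr_norml => /andP[]; move: s1 s2 d1; clear; lra.
- apply/box3P; rewrite !line_coord /= !add0r p0 lexx; split => //.
  by move: s1 s2; clear; lra.
- split=> // i j; rewrite (ord1 i); move: j; apply: forall_I3.
  all: rewrite /ball /= !line_coord /= ?add0r.
  + by rewrite p0 q0 subrr normr0.
  + by rewrite opprD addrACA subrr add0r (lt_le_trans x1).
  + exact: lt_le_trans x2 dr.
Qed.

(** Comparison with the barrier centred at the point below p, started e
    above the initial value there.  It dominates w at time 0 by the modulus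
    hypothesis; on the walls w vanishes at all times, so there the modulus
    hypothesis at time 0 suffices again; on the artificial lateral sides the
    paraboloid exceeds the bound of w once their distance rho is large. *)
Lemma heat_flow_upper (R : realType) (nu L1 L2 e K : R) (w : 'rV[R]_3 -> R) :
  0 < nu -> 0 < K -> heat_flow nu L1 L2 w ->
  (forall p q, closed_domain L1 L2 p -> closed_domain L1 L2 q ->
    p 0 0 = 0 -> q 0 0 = 0 ->
    w q <= w p + e + K * ((q 0 1 - p 0 1) ^+ 2 + (q 0 2 - p 0 2) ^+ 2)) ->
  forall p, closed_domain L1 L2 p ->
    w p <= w ((- p 0 0) *: delta_mx 0 0 + p) + e + 7 * nu * K * p 0 0.
Proof.
move=> nu0 K0 [Cw cw heat wall per] mod p Dp.
have start r : closed_domain L1 L2 r ->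
    closed_domain L1 L2 ((- r 0 0) *: delta_mx 0 0 + r) /\
    ((- r 0 0) *: delta_mx 0 0 + r) 0 0 = 0.
  by case=> _ r2; rewrite /closed_domain /= !line_coord /= !add0r addNr lexx.
have [Dz z0] := start p Dp.
have [z1 z2] : ((- p 0 0) *: delta_mx 0 0 + p) 0 1 = p 0 1 /\
    ((- p 0 0) *: delta_mx 0 0 + p) 0 2 = p 0 2.
  by rewrite !line_coord /= !add0r.
move: Dz z0 z1 z2; set z := _ + p => Dz z0 z1 z2.
have [M Mw] := @periodic_bounded _ L1 L2 (p 0 0) w cw per.
have M0 : 0 <= M by apply: le_trans (Mw _ Dp _).
(* Since rho >= 1, K rho ^ 2 >= K rho >= 2 M. *)
pose rho := 2 * M / K + 1.
have rho0 : 0 <= rho by rewrite addr_ge0// divr_ge0// ?mulr_ge0// ltW.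
have Krho : 2 * M <= K * rho ^+ 2.
  have : K * rho <= K * rho ^+ 2.
    by rewrite ler_pM2l// expr2 ler_peMr// lerDr divr_ge0// ?mulr_ge0// ltW.
  move=> Kr; apply: le_trans Kr; rewrite /rho mulrDr mulr1 (mulrC K) divfK ?gt_eqF//.
  by rewrite lerDl ltW.
have e0 : 0 <= e.
  have := mod z z Dz Dz z0 z0; rewrite !subrr expr0n /= addr0 mulr0.
  by clear; lra.
pose Q := box (vec3 0 (z 0 1 - rho) L1) (vec3 (p 0 0) (z 0 1 + rho) L2).
have QD : Q `<=` closed_domain L1 L2.
  by move=> r /box3P[/andP[r0 _] _ r2].
have kappa0 : 0 <= 7 * nu * K by rewrite !mulr_ge0// ltW.
have wz : - M <= w z.
  have := Mw z Dz; rewrite z0 => /(_ _); case: Dp => p0 _ /(_ p0).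
  by rewrite ler_norml => /andP[].
suff : w p <= barrier (w z + e) K (7 * nu * K) z p.
  by rewrite /barrier z1 z2 !subrr expr0n /= addr0 mulr0 addr0.
apply: (@heat_comparison _ nu L1 L2 (p 0 0) rho) => //.
- by have := mulr_gt0 nu0 K0; clear; lra.
- exact: continuous_subspaceW QD cw.
- move=> r /QD Dr r0; rewrite /barrier r0 mulr0 addr0.
  exact: mod.
- move=> r Qr side; have Dr := QD _ Qr.
  have [/andP[r0 rp] _ _] := (box3P _ _ _ _ _ _ _).1 Qr.
  have := Mw r Dr rp; rewrite ler_norml => /andP[_ wr].
  have side2 : (r 0 1 - z 0 1) ^+ 2 = rho ^+ 2.
    by rewrite -side real_normK ?num_real.
  rewrite /barrier side2 mulrDr.
  have := mulr_ge0 (ltW K0) (sqr_ge0 (r 0 2 - z 0 2)).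
  have := mulr_ge0 kappa0 r0.
  by move: wr wz Krho e0; clear; lra.
- move=> r Qr side; have Dr := QD _ Qr.
  have [/andP[r0 rp] _ _] := (box3P _ _ _ _ _ _ _).1 Qr.
  have [Ds s0] := start r Dr.
  have [s1 s2] : ((- r 0 0) *: delta_mx 0 0 + r) 0 1 = r 0 1 /\
      ((- r 0 0) *: delta_mx 0 0 + r) 0 2 = r 0 2.
    by rewrite !line_coord /= !add0r.
  have := mod _ _ Dz Ds z0 s0; rewrite (wall _ Ds) ?s2// s1 (wall _ Dr)//.
  by rewrite /barrier => /le_trans; apply; rewrite lerDl mulr_ge0.
- case: Dp => p0 p2; apply/box3P; rewrite p0 lexx z1; split => //.
  by move: rho0; clear; lra.
Qed.

(** The bound is uniform in p up to the walls, and nu enters only through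
    the rate 7 nu K: this is what excludes a boundary layer. *)
Lemma heat_flow_near_initial (R : realType) (nu L1 L2 e K : R)
    (w : 'rV[R]_3 -> R) :
  0 < nu -> 0 < K -> heat_flow nu L1 L2 w ->
  (forall p q, closed_domain L1 L2 p -> closed_domain L1 L2 q ->
    p 0 0 = 0 -> q 0 0 = 0 ->
    `|w q - w p| <= e + K * ((q 0 1 - p 0 1) ^+ 2 + (q 0 2 - p 0 2) ^+ 2)) ->
  forall p, closed_domain L1 L2 p ->
    `|w p - w ((- p 0 0) *: delta_mx 0 0 + p)| <= e + 7 * nu * K * p 0 0.
Proof.
move=> nu0 K0 hw mod p Dp.
have upper := @heat_flow_upper _ nu L1 L2 e K w nu0 K0 hw.
have lower := @heat_flow_upper _ nu L1 L2 e K _ nu0 K0 (heat_flowN hw).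
have {}upper : w p <= w ((- p 0 0) *: delta_mx 0 0 + p) + e + 7 * nu * K * p 0 0.
  apply: upper => // q r Dq Dr q0 r0.
  by have := mod q r Dq Dr q0 r0; rewrite ler_norml => /andP[_]; clear; lra.
have {}lower :
    - w p <= - w ((- p 0 0) *: delta_mx 0 0 + p) + e + 7 * nu * K * p 0 0.
  apply: lower => // q r Dq Dr q0 r0.
  by have := mod q r Dq Dr q0 r0; rewrite ler_norml => /andP[+ _]; clear; lra.
by rewrite ler_norml; apply/andP; move: upper lower; clear; split; lra.
Qed.

(** * Shear flows *)

Lemma sum3 (V : nmodType) (F : 'I_3 -> V) : \sum_(j < 3) F j = F 0 + F 1 + F 2.
Proof.
rewrite !big_ord_recl big_ord0 addr0 addrA.
by congr (F _ + F _ + F _); apply/val_inj.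
Qed.

Lemma continuous_row (R : realType) (T : topologicalType) (n : nat)
    (u : T -> 'rV[R]_n) :
  (forall i, continuous (fun x => u x 0 i)) -> continuous u.
Proof.
move=> cu x; apply/cvg_ballP => e e0.
have : \forall y \near x, forall i, ball (u x 0 i) e (u y 0 i).
  apply: filter_forall => i; have /cvg_ballP := cu i x; exact.
apply: filterS => y uy; split=> // i j; rewrite (ord1 i); exact: uy.
Qed.

Lemma continuous_coordD (R : realType) (n : nat) (i j : 'I_n.+1) :
  continuous (fun x : 'rV[R]_n.+1 => x 0 i + x 0 j).
Proof.
move=> x.
exact: (continuousD (@coord_continuous _ _ _ 0 i x) (@coord_continuous _ _ _ 0 j x)).
Qed.

(** The point (t, xi, eta) at which phi is evaluated by the velocity at (t,
    x). *)
Definition spacetime (R : realType) (t : R) (x : 'rV[R]_3) : 'rV[R]_3 :=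
  vec3 t (x 0 0 + x 0 1) (x 0 2).

Definition shear_plane (R : realType) (x : 'rV[R]_3) : 'rV[R]_2 :=
  \row_(j < 2) [:: x 0 0 + x 0 1; x 0 2]`_j.

Lemma forall_I2 (P : 'I_2 -> Prop) : P 0 -> P 1 -> forall i, P i.
Proof.
move=> P0 P1 [[|[|//]] i2].
- by have <- : 0 = Ordinal i2 by apply/val_inj.
- by have <- : 1 = Ordinal i2 by apply/val_inj.
Qed.

Lemma shear_planeE (R : realType) (x : 'rV[R]_3) :
  (shear_plane x 0 0 = x 0 0 + x 0 1) * (shear_plane x 0 1 = x 0 2).
Proof. by rewrite /shear_plane !mxE. Qed.

Lemma spacetime_axis (R : realType) (t : R) :
  axis_map (spacetime t) (fun j => if j == 2 then 2 else 1).
Proof.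
move=> j h x; apply/rowP; apply: forall_I3; move: j; apply: forall_I3 => /=.
all: rewrite !mxE /= ?mulr0 ?mulr1 ?add0r //.
  by rewrite addrA.
by rewrite addrCA.
Qed.

Lemma shear_plane_axis (R : realType) :
  axis_map (@shear_plane R) (fun j => if j == 2 then 1 else 0).
Proof.
move=> j h x; apply/rowP; apply: forall_I2; move: j; apply: forall_I3 => /=.
all: rewrite !mxE /= ?mulr0 ?mulr1 ?add0r //.
  by rewrite addrA.
by rewrite addrCA.
Qed.

Lemma spacetime_continuous (R : realType) :
  continuous (fun p : R * 'rV[R]_3 => spacetime p.1 p.2).
Proof.
have c1 : continuous (fun p : R * 'rV[R]_3 => p.1) by move=> p; exact: cvg_fst.
have c2 : continuous (fun p : R * 'rV[R]_3 => p.2) by move=> p; exact: cvg_snd.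
apply: continuous_row; apply: forall_I3; rewrite /spacetime.
- rewrite [X in continuous X](_ : _ = fun p => p.1)//.
  by apply/funext => p; rewrite !vec3E.
- rewrite [X in continuous X](_ : _ = fun p : R * 'rV_3 => p.2 0 0 + p.2 0 1).
    by move=> p; exact: (continuous_comp (c2 p) (@continuous_coordD R 2 0 1 p.2)).
  by apply/funext => p; rewrite !vec3E.
- rewrite [X in continuous X](_ : _ = fun p : R * 'rV_3 => p.2 0 2).
    by move=> p; exact: (continuous_comp (c2 p) (@coord_continuous R 1 3 0 2 p.2)).
  by apply/funext => p; rewrite !vec3E.
Qed.

Lemma spacetime_slice_continuous (R : realType) (t : R) :
  continuous (spacetime t).
Proof.
move=> x; apply: (@continuous_comp _ _ _ (fun y => (t, y))
  (fun p : R * 'rV[R]_3 => spacetime p.1 p.2)); last exact: spacetime_continuous.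
exact: (@cvg_pair _ _ _ (nbhs x) (nbhs t) (nbhs x) _ _ _
  (fun=> t) id (cvg_cst t) cvg_id).
Qed.

Lemma shear_plane_continuous (R : realType) : continuous (@shear_plane R).
Proof.
apply: continuous_row; apply: forall_I2.
- rewrite [X in continuous X](_ : _ = fun y : 'rV_3 => y 0 0 + y 0 1).
    exact: continuous_coordD.
  by apply/funext => y; rewrite !shear_planeE.
- rewrite [X in continuous X](_ : _ = fun y : 'rV_3 => y 0 2).
    exact: coord_continuous.
  by apply/funext => y; rewrite !shear_planeE.
Qed.

(** A flow along (-1, 1, 0).  When its speed g depends on x1 and x2 through
    x1 + x2 only, that is d_1 g = d_2 g, the speed is constant along the
    flow: the field is divergence free and transports itself trivially. *)
Definition shear (R : realType) (g : 'rV[R]_3 -> R) (x : 'rV[R]_3) : 'rV[R]_3 :=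
  vec3 (- g x) (g x) 0.

Lemma shear_coord (R : realType) (g : 'rV[R]_3 -> R) :
  ((fun x => shear g x 0 0) = (fun x => - g x)) *
  ((fun x => shear g x 0 1) = g) * ((fun x => shear g x 0 2) = fun=> 0).
Proof. by do !split; apply/funext => x; rewrite /shear vec3E. Qed.

Lemma partial_cst (R : realType) (n : nat) (j : 'I_n.+1) (c : R) :
  partial j (fun=> c) = fun=> 0.
Proof. by apply/funext => x; exact: derive_cst. Qed.

Lemma shear_divergence (R : realType) (g : 'rV[R]_3 -> R) x :
  partial 0 g = partial 1 g -> divergence (shear g) x = 0.
Proof.
move=> g01; rewrite /divergence sum3 !shear_coord partialN partial_cst g01.
by rewrite addr0 addNr.
Qed.

Lemma shear_convection (R : realType) (g : 'rV[R]_3 -> R) i x :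
  partial 0 g = partial 1 g -> convection (shear g) i x = 0.
Proof.
move=> g01; rewrite /convection sum3 /shear !vec3E -/(shear g) mul0r addr0.
move: i; apply: forall_I3.
- by rewrite (shear_coord g) !partialN g01; ring.
- by rewrite (shear_coord g) g01; ring.
- by rewrite (shear_coord g) !partial_cst; ring.
Qed.

Lemma shear_class_C (R : realType) (k : nat) (A : set 'rV[R]_3)
    (g : 'rV[R]_3 -> R) : class_C k A g ->
  forall i, class_C k A (fun x => shear g x 0 i).
Proof.
move=> Cg; apply: forall_I3; rewrite shear_coord //; first exact: class_CN.
exact: class_C_cst.
Qed.

Definition dxi (R : realType) (psi : R -> R -> R) (xi eta : R) : R :=
  'D_1 (fun s => psi s eta) xi.

Lemma u_ppE (R : realType) (psi : R -> R -> R) :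
  u_pp psi = shear (fun x => dxi psi (x 0 0 + x 0 1) (x 0 2)).
Proof.
apply/funext => x; rewrite /u_pp /shear.
have E (j : 'I_3) : j != 2 -> partial j (fun y : 'rV_3 => psi (y 0 0 + y 0 1) (y 0 2)) x
    = dxi psi (x 0 0 + x 0 1) (x 0 2).
  move=> j2; apply: eq_derive_lines => h; rewrite !line_coord [h *: (1 : R)]mulr1.
  move: j j2; apply: forall_I3 => //= _; rewrite !add0r ?addr0 //.
    by rewrite addrA.
  by rewrite addrCA.
by rewrite !E.
Qed.

Lemma partial_on_R3 (R : realType) (phi : R -> R -> R -> R) (p : 'rV[R]_3) :
  partial 1 (on_R3 phi) p = dxi (phi (p 0 0)) (p 0 1) (p 0 2).
Proof.
apply: eq_derive_lines => h; rewrite /on_R3 !line_coord /= !add0r.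
by rewrite [h *: (1 : R)]mulr1.
Qed.

Lemma partial_on_R2 (R : realType) (phi0 : R -> R -> R) (q : 'rV[R]_2) :
  partial 0 (on_R2 phi0) q = dxi phi0 (q 0 0) (q 0 1).
Proof.
apply: eq_derive_lines => h; rewrite /on_R2 !line_coord /= !add0r.
by rewrite [h *: (1 : R)]mulr1.
Qed.

Lemma eq_dxi (R : realType) (psi chi : R -> R -> R) (eta : R) :
  (forall xi, psi xi eta = chi xi eta) -> forall xi, dxi psi xi eta = dxi chi xi eta.
Proof.
by move=> E xi; rewrite /dxi; congr derive; apply/funext => s; exact: E.
Qed.

Lemma dxi_cst (R : realType) (psi : R -> R -> R) (eta c : R) :
  (forall xi, psi xi eta = c) -> forall xi, dxi psi xi eta = 0.
Proof.
move=> E xi; rewrite (@eq_dxi _ _ (fun _ _ => c) _ E); exact: derive_cst.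
Qed.

Lemma dxi_periodic (R : realType) (psi : R -> R -> R) (eta T : R) :
  (forall xi, psi (xi + T) eta = psi xi eta) ->
  forall xi, dxi psi (xi + T) eta = dxi psi xi eta.
Proof.
by move=> E xi; apply: eq_derive_lines => h; rewrite addrA E.
Qed.

Lemma u_pp_periodic (R : realType) (L1 L2 : R) (psi : R -> R -> R) :
  (forall xi eta, L1 < eta < L2 -> psi (xi + 2 * pi) eta = psi xi eta) ->
  periodic12 L1 L2 (u_pp psi).
Proof.
move=> per x1 x2 x3 h3; rewrite u_ppE /shear !vec3E.
have E := dxi_periodic (fun xi => per xi x3 h3).
by rewrite addrAC addrA !E.
Qed.

(** * The heat flow of the velocity *)

Lemma open_coord (R : realType) (n : nat) (i : 'I_n.+1) (B : set R) :
  open B -> open [set x : 'rV[R]_n.+1 | B (x 0 i)].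
Proof.
move=> oB; apply: (@open_comp _ _ (fun x : 'rV[R]_n.+1 => x 0 i) B) => //.
by move=> x _; exact: coord_continuous.
Qed.

Lemma open_between (R : realType) (n : nat) (i : 'I_n.+1) (a b : R) :
  open [set x : 'rV[R]_n.+1 | a < x 0 i < b].
Proof.
suff -> : [set x : 'rV[R]_n.+1 | a < x 0 i < b] =
    [set x | `]a, b[%classic (x 0 i)] by apply: open_coord; exact: interval_open.
by apply/seteqP; split => x /=; rewrite in_itv.
Qed.

Lemma open_open_domain (R : realType) (L1 L2 : R) : open (open_domain L1 L2).
Proof.
rewrite (_ : open_domain _ _ =
  [set x | [set r | 0 < r] (x 0 0)] `&` [set x | L1 < x 0 2 < L2]).
  by apply: openI; [apply: open_coord; exact: open_gt|exact: open_between].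
by apply/seteqP; split.
Qed.

(** The equation has constant coefficients and holds on an open set, so it
    can be differentiated; moving d_b inside the second derivatives is
    Schwarz's theorem. *)
Lemma heat_equation_partial (R : realType) (n : nat) (A : set 'rV[R]_n.+1)
    (a b c : 'I_n.+1) (nu : R) (f : 'rV[R]_n.+1 -> R) :
  open A -> class_C 3 A f ->
  (forall p, A p -> partial a f p
     - nu * (2 * partial b (partial b f) p + partial c (partial c f) p) = 0) ->
  forall p, A p -> partial a (partial b f) p
     - nu * (2 * partial b (partial b (partial b f)) p
             + partial c (partial c (partial b f)) p) = 0.
Proof.
move=> oA C3 heat p Ap.
have C2 := class_CW C3.
have Cp j : class_C 2 A (partial j f) by have [_ /(_ j)[]] := C3.
have Cpp i j : class_C 1 A (partial i (partial j f)).
  by have [_ /(_ i)[]] := Cp j.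
have dp i j : derivable (partial j f) p (delta_mx 0 i).
  by have [_ /(_ i)[d _]] := Cp j; exact: d.
have dpp i j k : derivable (partial j (partial k f)) p (delta_mx 0 i).
  by have [_ /(_ i)[d _]] := Cpp j k; exact: d.
have nearA : \forall q \near p, A q by exact: open_nbhs_nbhs.
have swap_ab : partial a (partial b f) p = partial b (partial a f) p.
  exact: partial_comm C2 Ap.
have swap_cb : partial c (partial c (partial b f)) p =
    partial b (partial c (partial c f)) p.
  rewrite -(partial_comm _ _ oA (Cp c) Ap); apply: near_eq_derive.
  by apply: filterS nearA => q Aq; exact: partial_comm C2 Aq.
rewrite swap_ab swap_cb.
have dsum : is_derive p (delta_mx 0 b : 'rV[R]_n.+1)
   (partial a f - nu \*: (2 \*: partial b (partial b f) + partial c (partial c f)))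
   (partial b (partial a f) p - nu *: (2 *: partial b (partial b (partial b f)) p
             + partial b (partial c (partial c f)) p)).
  apply: is_deriveB; first exact/derivableP.
  apply: is_deriveZ; apply: is_deriveD; last exact/derivableP.
  by apply: is_deriveZ; exact/derivableP.
have [_ <-] := dsum.
rewrite (@near_eq_derive _ _ _ _ (cst 0)); first exact: derive_cst.
by apply: filterS nearA => q /heat.
Qed.

Lemma heat_flow_dxi (R : realType) (nu L1 L2 : R) (phi : R -> R -> R -> R) :
  regular L1 L2 phi ->
  (forall p : 'rV[R]_3, open_domain L1 L2 p ->
     partial 0 (on_R3 phi) p
       - nu * (2 * partial 1 (partial 1 (on_R3 phi)) p
               + partial 2 (partial 2 (on_R3 phi)) p) = 0) ->
  (forall t xi eta : R, 0 <= t -> L1 < eta < L2 ->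
     phi t (xi + 2 * pi) eta = phi t xi eta) ->
  (forall t xi : R, 0 <= t -> phi t xi L1 = 0 /\ phi t xi L2 = 0) ->
  heat_flow nu L1 L2 (partial 1 (on_R3 phi)).
Proof.
move=> [C3 _ _ cw] heat per wall; split.
- by have [_ /(_ 1)[]] := C3.
- exact: cw.
- exact: heat_equation_partial (@open_open_domain _ _ _) C3 heat.
- move=> p [p0 _] [] p2; rewrite partial_on_R3 p2; apply: (@dxi_cst _ _ _ 0) => xi.
    by have [] := wall (p 0 0) xi p0.
  by have [] := wall (p 0 0) xi p0.
- move=> p [p0 /andP[p1 p2]]; rewrite !partial_on_R3 !line_coord /= !add0r.
  rewrite addrC; apply: dxi_periodic => xi.
  move: p1 p2; rewrite !le_eqVlt => /orP[/eqP<- _|p1 /orP[/eqP->|p2]].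
  + by have [-> _] := wall (p 0 0) (xi + 2 * pi) p0; have [-> _] := wall (p 0 0) xi p0.
  + by have [_ ->] := wall (p 0 0) (xi + 2 * pi) p0; have [_ ->] := wall (p 0 0) xi p0.
  + by apply: per => //; apply/andP.
Qed.

(** * Navier-Stokes and Euler equations *)

Lemma spacetime_domain (R : realType) (L1 L2 t : R) (x : 'rV[R]_3) :
  0 < t -> strip L1 L2 x -> open_domain L1 L2 (spacetime t x).
Proof. by rewrite /open_domain /strip /spacetime /= !vec3E. Qed.

Lemma spacetime_closed_domain (R : realType) (L1 L2 t : R) (x : 'rV[R]_3) :
  0 <= t -> closed_strip L1 L2 x -> closed_domain L1 L2 (spacetime t x).
Proof. by rewrite /closed_domain /closed_strip /spacetime /= !vec3E. Qed.

Lemma spacetime_time (R : realType) (s t : R) (x : 'rV[R]_3) :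
  spacetime (s + t) x = s *: delta_mx 0 0 + spacetime t x.
Proof.
apply/rowP; apply: forall_I3; rewrite !mxE /= ?mulr0 ?mulr1 ?add0r //.
Qed.

(** The derivatives along x1 and x2 are both d_xi, whence the factor 2 in
    the heat equation of phi. *)
Lemma spacetime_laplacian (R : realType) (t : R) (w : 'rV[R]_3 -> R) x :
  laplacian (w \o spacetime t) x =
  2 * partial 1 (partial 1 w) (spacetime t x)
  + partial 2 (partial 2 w) (spacetime t x).
Proof.
rewrite /laplacian sum3 !(partial_axis_map _ _ (@spacetime_axis R t)) /=.
by rewrite mulr2n mulrDl mul1r.
Qed.

Lemma laplacianN (R : realType) (n : nat) (f : 'rV[R]_n.+1 -> R) x :
  laplacian (fun y => - f y) x = - laplacian f x.
Proof.
by rewrite /laplacian -sumrN; apply: eq_bigr => j _; rewrite !partialN.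
Qed.

Lemma laplacian_cst (R : realType) (n : nat) (c : R) (x : 'rV[R]_n.+1) :
  laplacian (fun=> c) x = 0.
Proof. by rewrite /laplacian big1// => j _; rewrite !partial_cst. Qed.

(** The convection term vanishes for a shear flow, so the pressure may be
    taken to be 0 and each component is left with the heat equation for w. *)
Lemma shear_navier_stokes (R : realType) (nu L1 L2 : R) (w : 'rV[R]_3 -> R)
    (u0 : 'rV[R]_3 -> 'rV[R]_3) : L1 < L2 -> heat_flow nu L1 L2 w ->
  (forall x, closed_strip L1 L2 x -> shear (w \o spacetime 0) x = u0 x) ->
  navier_stokes_solution nu L1 L2 u0 (fun t => shear (w \o spacetime t))
    (fun _ _ => 0).
Proof.
move=> L12 [Cw cw heat wall per] init.
have sym t : partial 0 (w \o spacetime t) = partial 1 (w \o spacetime t).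
  by rewrite !(partial_axis_map _ _ (@spacetime_axis R t)).
split.
- move=> t t0; split; first exact: class_C_cst.
  apply: shear_class_C.
  apply: class_C_axis_map (@spacetime_axis R t) _ _ Cw.
    exact: spacetime_slice_continuous.
  by move=> x; exact: spacetime_domain.
- move=> t x t0 Sx; split; first exact: shear_divergence.
  have Dx := spacetime_domain t0 Sx.
  have E (h : R) : w (h *: delta_mx 0 0 + spacetime t x) =
      w (spacetime (h *: (1 : R) + t) x).
    by rewrite [h *: (1 : R)]mulr1 spacetime_time.
  have dt : derivable (fun s => w (spacetime s x)) t 1.
    apply: (eq_derivable_lines E).
    by have [_ /(_ 0)[d _]] := Cw; exact: d.
  have Dt : 'D_1 (fun s => w (spacetime s x)) t = partial 0 w (spacetime t x).
    by apply/esym; exact: eq_derive_lines E.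
  have := heat _ Dx; rewrite -spacetime_laplacian -Dt => {}heat.
  move=> i; rewrite shear_convection// partial_cst !addr0; move: i.
  apply: forall_I3; rewrite shear_coord.
  + rewrite (_ : (fun s => _) = (fun s => - w (spacetime s x))); last first.
      by apply/funext => s; rewrite /shear vec3E.
    split; first exact: derivableN.
    rewrite deriveN_total laplacianN mulrN opprK -[RHS]oppr0 -[in RHS]heat.
    by rewrite opprD opprK.
  + rewrite (_ : (fun s => _) = (fun s => w (spacetime s x))) //.
    by apply/funext => s; rewrite /shear vec3E.
  + rewrite (_ : (fun s => _) = (fun=> 0)); last first.
      by apply/funext => s; rewrite /shear vec3E.
    split; first exact: derivable_cst.
    by rewrite derive_cst laplacian_cst mulr0 subr0.
- split=> [t t0 x1 x2 x3 /andP[h1 h2]|t x1 x2 t0].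
    have Dx : closed_domain L1 L2 (spacetime t (vec3 x1 x2 x3)).
      apply: spacetime_closed_domain => //.
      by rewrite /closed_strip /= vec3E !ltW.
    have E : spacetime t (vec3 (x1 + 2 * pi) x2 x3) =
        (2 * pi) *: delta_mx 0 1 + spacetime t (vec3 x1 x2 x3).
      apply/rowP; apply: forall_I3; rewrite !mxE /= ?mulr0 ?mulr1 ?add0r //.
      by rewrite addrAC addrC.
    have E' : spacetime t (vec3 x1 (x2 + 2 * pi) x3) =
        (2 * pi) *: delta_mx 0 1 + spacetime t (vec3 x1 x2 x3).
      apply/rowP; apply: forall_I3; rewrite !mxE /= ?mulr0 ?mulr1 ?add0r //.
      by rewrite addrA addrC.
    by rewrite /shear /= E E' per.
  have vanish x3 : L1 <= x3 <= L2 -> x3 = L1 \/ x3 = L2 ->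
      shear (w \o spacetime t) (vec3 x1 x2 x3) = 0.
    move=> h3 h; rewrite /shear /= wall ?oppr0.
    + by apply/rowP; apply: forall_I3; rewrite !mxE.
    + by apply: spacetime_closed_domain; rewrite // /closed_strip /= !vec3E.
    + by rewrite /spacetime !vec3E.
  by split; apply: vanish; rewrite ?lexx ?(ltW L12); auto.
- exact: init.
- rewrite (_ : (fun p => _) = (fun p : R * 'rV[R]_3 =>
      w (spacetime p.1 p.2) *: vec3 (- 1) 1 0)); last first.
    apply/funext => p; apply/rowP; apply: forall_I3;
      by rewrite !mxE /= ?mulrN ?mulr1 ?mulr0.
  apply/subspace_continuousP => p [p0 Sp].
  apply: cvgZ; last exact: cvg_cst.
  have Dp := spacetime_closed_domain p0 Sp.
  apply: (@cvg_comp _ _ _ (fun p : R * 'rV[R]_3 => spacetime p.1 p.2) w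
    _ (within (closed_domain L1 L2) (nbhs (spacetime p.1 p.2)))); last first.
    exact: ((subspace_continuousP _ _).1 cw).
  move=> B /(spacetime_continuous (x := p)); rewrite /= !nbhs_simpl /within /=.
  apply: filterS => q /= qB [q0 Sq]; apply: qB.
  exact: spacetime_closed_domain.
Qed.

Lemma shear_static_euler (R : realType) (L1 L2 : R) (g : 'rV[R]_3 -> R) :
  class_C 1 (strip L1 L2) g -> partial 0 g = partial 1 g ->
  static_euler_solution L1 L2 (shear g) (fun=> 0).
Proof.
move=> Cg g01; split.
- exact: class_C_cst.
- exact: shear_class_C.
- by move=> x _ i; rewrite shear_convection// partial_cst addr0.
- by move=> x _; exact: shear_divergence.
Qed.

(** * Inviscid limit *)

(** The modulus of continuity is that of the common initial value w0,
    extracted from the flow with viscosity 1; hence K does not depend on nu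
    and the rate 7 nu K T tends to 0. *)
Lemma heat_flow_inviscid_limit (R : realType) (L1 L2 : R)
    (w : R -> 'rV[R]_3 -> R) (w0 : R -> R -> R) :
  (forall nu, 0 < nu -> heat_flow nu L1 L2 (w nu)) ->
  (forall nu, 0 < nu -> forall p, closed_domain L1 L2 p -> p 0 0 = 0 ->
     w nu p = w0 (p 0 1) (p 0 2)) ->
  forall T e : R, 0 <= T -> 0 < e -> \forall nu \near 0^'+,
    forall p, closed_domain L1 L2 p -> p 0 0 <= T ->
      `|w nu p - w0 (p 0 1) (p 0 2)| < e.
Proof.
move=> hw hw0 T e T0 e0.
have e40 : 0 < e / 4 by rewrite divr_gt0.
have [K K0 mod] : exists2 K : R, 0 < K & forall p q, closed_domain L1 L2 p ->
    closed_domain L1 L2 q -> p 0 0 = 0 -> q 0 0 = 0 ->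
    `|w0 (q 0 1) (q 0 2) - w0 (p 0 1) (p 0 2)|
    <= e / 4 + K * ((q 0 1 - p 0 1) ^+ 2 + (q 0 2 - p 0 2) ^+ 2).
  have [_ cw _ _ per] := hw 1 ltr01.
  have [K K0 mod] := @initial_modulus _ L1 L2 (w 1) (e / 4) cw per e40.
  exists K => // p q Dp Dq p0 q0.
  by rewrite -(hw0 1 ltr01 p Dp p0) -(hw0 1 ltr01 q Dq q0); exact: mod.
have T10 : 0 < 14 * K * (T + 1) by rewrite !mulr_gt0// ltr_wpDl.
have nu1 : \forall nu \near (0 : R)^'+, nu < e / (14 * K * (T + 1)).
  by apply: nbhs_right_lt; rewrite divr_gt0.
have nu2 : \forall nu \near (0 : R)^'+, 0 < nu by exact: nbhs_right_gt.
apply: filterS2 nu1 nu2 => nu nue nu0 p Dp pT.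
have := @heat_flow_near_initial _ nu L1 L2 (e / 4) K (w nu) nu0 K0 (hw nu nu0).
have Dz : closed_domain L1 L2 ((- p 0 0) *: delta_mx 0 0 + p).
  by case: Dp => _ p2; rewrite /closed_domain /= !line_coord /= !add0r addNr.
move=> /(_ _ p Dp); rewrite (hw0 nu nu0 _ Dz); last by rewrite line_coord /= addNr.
rewrite !line_coord /= !add0r => near.
apply: le_lt_trans (near _) _ => [q r Dq Dr q0 r0|].
  by rewrite !(hw0 nu nu0)//; exact: mod.
have : 7 * nu * K * p 0 0 <= 7 * nu * K * (T + 1).
  by rewrite ler_wpM2l ?mulr_ge0 ?(ltW nu0) ?(ltW K0)//; lra.
move: nue; rewrite ltr_pdivlMr//; move: e0; clear.
set a := 7 * _ * _ * p 0 0; nra.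
Qed.

Lemma ball_shear (R : realType) (g h : 'rV[R]_3 -> R) (e : R) (x y : 'rV[R]_3) :
  0 < e -> `|h y - g x| < e -> ball (shear g x) e (shear h y).
Proof.
move=> e0 gh; split => // i j; rewrite (ord1 i); move: j.
apply: forall_I3; rewrite !vec3E /ball /=.
- by rewrite opprK addrC.
- by rewrite distrC.
- by rewrite subrr normr0.
Qed.

(* phi nu t xi eta : the solution of the heat problem with viscosity nu. *)
Theorem corollary1p9 (R : realType) (L1 L2 : R) (hL : L1 < L2)
    (phi : R -> R -> R -> R -> R) (phi0 : R -> R -> R)
    (hreg : forall nu : R, 0 < nu -> regular L1 L2 (phi nu))
    (hreg0 : regular_initial L1 L2 phi0)
    (hheat : forall nu : R, 0 < nu ->
       forall p : 'rV[R]_3, open_domain L1 L2 p ->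
         partial 0 (on_R3 (phi nu)) p
           - nu * (2 * partial 1 (partial 1 (on_R3 (phi nu))) p
                   + partial 2 (partial 2 (on_R3 (phi nu))) p) = 0)
    (hper : forall nu : R, 0 < nu ->
       forall t xi eta : R, 0 <= t -> L1 < eta < L2 ->
         phi nu t (xi + 2 * pi) eta = phi nu t xi eta)
    (hwall : forall nu : R, 0 < nu ->
       forall t xi : R, 0 <= t ->
         phi nu t xi L1 = 0 /\ phi nu t xi L2 = 0)
    (hinit : forall nu : R, 0 < nu ->
       forall xi eta : R, L1 <= eta <= L2 ->
         phi nu 0 xi eta = phi0 xi eta) :
  let u_ns := fun (nu t : R) (x : 'rV[R]_3) => u_pp (phi nu t) x in
  let u_e0 := fun x : 'rV[R]_3 => u_pp phi0 x in
  [/\ (forall nu : R, 0 < nu ->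
         exists P : R -> 'rV[R]_3 -> R,
           navier_stokes_solution nu L1 L2 u_e0 (u_ns nu) P),
      (forall (t : R) (x : 'rV[R]_3), 0 <= t -> closed_strip L1 L2 x ->
         u_ns nu t x @[nu --> 0^'+] --> u_e0 x),
      (exists P : 'rV[R]_3 -> R, static_euler_solution L1 L2 u_e0 P),
      periodic12 L1 L2 u_e0 /\
      (forall x1 x2 : R,
         u_e0 (vec3 x1 x2 L1) 0 2 = 0 /\ u_e0 (vec3 x1 x2 L2) 0 2 = 0) &
      no_prandtl_layer L1 L2 u_ns u_e0].
Proof.
move=> u_ns u_e0.
pose w nu := partial 1 (on_R3 (phi nu)).
have hw nu : 0 < nu -> heat_flow nu L1 L2 (w nu).
  move=> nu0; apply: heat_flow_dxi.
  - exact: hreg.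
  - exact: hheat.
  - exact: hper.
  - exact: hwall.
have hw0 nu : 0 < nu -> forall p, closed_domain L1 L2 p -> p 0 0 = 0 ->
    w nu p = dxi phi0 (p 0 1) (p 0 2).
  move=> nu0 p [_ p2] p0; rewrite /w partial_on_R3 p0; apply: eq_dxi => xi.
  exact: hinit.
have u_nsE nu t : u_ns nu t = shear (w nu \o spacetime t).
  rewrite /u_ns; apply/funext => x; rewrite u_ppE /shear /= /w partial_on_R3.
  by rewrite /spacetime !vec3E.
have u_e0E : u_e0 = shear (partial 0 (on_R2 phi0) \o @shear_plane R).
  rewrite /u_e0; apply/funext => x; rewrite u_ppE /shear /= partial_on_R2.
  by rewrite !shear_planeE.
have unif (T e : R) : 0 <= T -> 0 < e -> \forall nu \near 0^'+,
    forall t x, 0 <= t <= T -> closed_strip L1 L2 x ->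
    ball (u_e0 x) e (u_ns nu t x).
  move=> T0 e0; have := heat_flow_inviscid_limit hw hw0 T0 e0.
  apply: filterS => nu near t x /andP[t0 tT] Sx.
  rewrite u_nsE /u_e0 u_ppE; apply: ball_shear => //=.
  have := near _ (spacetime_closed_domain t0 Sx).
  by rewrite /spacetime !vec3E; apply.
split.
- move=> nu nu0; exists (fun _ _ => 0).
  rewrite (_ : u_ns nu = fun t => shear (w nu \o spacetime t)); last first.
    by apply/funext => t; exact: u_nsE.
  apply: (shear_navier_stokes hL (hw nu nu0)) => x Sx.
  rewrite /u_e0 u_ppE /shear /= (hw0 nu nu0) /spacetime ?vec3E//.
  exact: spacetime_closed_domain.
- move=> t x t0 Sx; apply/cvg_ballP => e e0.
  have := unif t e t0 e0; apply: filterS => nu; apply => //.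
  by rewrite t0 lexx.
- exists (fun=> 0); rewrite u_e0E; apply: shear_static_euler.
    have C1 : class_C 1 [set q : 'rV[R]_2 | L1 < q 0 1 < L2]
        (partial 0 (on_R2 phi0)) by have [_ /(_ 0)[]] := hreg0.
    apply: (class_C_axis_map (@shear_plane_axis R) _ _ C1).
      exact: shear_plane_continuous.
    by move=> x; rewrite /strip /= shear_planeE.
  by rewrite !(partial_axis_map _ _ (@shear_plane_axis R)).
- split; last by move=> x1 x2; rewrite /u_e0 u_ppE /shear !vec3E.
  apply: u_pp_periodic => xi eta h.
  have h' : L1 <= eta <= L2 by case/andP: h => *; rewrite !ltW.
  by rewrite -!(hinit 1 ltr01)//; apply: hper.
- move=> T T0 P /uniform_nbhs[E [entE subP]].
  have [e /= e0 eE] : exists2 e : R, 0 < e & forall x y, ball x e y -> E (x, y).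
    move: entE; rewrite -entourage_ballE => -[e e0 eE]; exists e => // x y xy.
    exact: (eE (x, y)).
  have := unif T e T0 e0; apply: filterS => nu near.
  by apply: subP => -[t x] /= [tT Sx]; apply: eE; exact: near.
Qed.
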